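(* Let $n\ge 2$ and let $\mathbf{c}=(c_1,\dots,c_n)\in\mathbb{R}^n_+$ be a nonnegative vector with $c_1=0$ such that the generalized Pascal matrix with generating vector $\mathbf{c}$ (the case $m=2$) is positive definite. Then for every $m\ge 2$, the $m$th order $n$-dimensional generalized Pascal tensor with generating vector $\mathbf{c}$ is strongly completely positive, and if $m$ is even it is positive definite.
   Context: For a nonnegative $\mathbf{c}\in\mathbb{R}^n$ and $m\ge 2$, the $m$th order $n$-dimensional generalized Pascal tensor with generating vector $\mathbf{c}$ is $\mathcal{A}=(a_{i_1\dots i_m})$ with $a_{i_1\dots i_m}=\frac{\Gamma(c_{i_1}+\dots+c_{i_m}+1)}{\Gamma(c_{i_1}+1)\cdots\Gamma(c_{i_m}+1)}$; for $m=2$ it is called the generalized Pascal matrix. A symmetric tensor of order $m$, dimension $n$ is strongly completely positive if it equals $\sum_{k=1}^r(\mathbf{u}^{(k)})^m$ for nonnegative vectors $\mathbf{u}^{(k)}\in\mathbb{R}^n$ spanning $\mathbb{R}^n$, where $\mathbf{u}^m$ has entries $u_{i_1}\cdots u_{i_m}$. For even $m$, it is positive definite if $\sum a_{i_1\dots i_m}x_{i_1}\cdots x_{i_m}>0$ for all nonzero $\mathbf{x}\in\mathbb{R}^n$. *)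

(* Defs.v *)
From HB Require Import structures.
From mathcomp Require Import all_boot all_order all_algebra.
From mathcomp Require Import all_classical all_reals all_analysis.
Set Implicit Arguments. Unset Strict Implicit. Unset Printing Implicit Defensive.
Import Order.TTheory GRing.Theory Num.Theory.
Local Open Scope ring_scope.
Local Open Scope classical_set_scope.

Definition Gamma (R : realType) (x : R) : R :=
  fine (\int[@lebesgue_measure R]_(t in `]0%R, +oo[) ((t `^ (x - 1)) * expR (- t))%:E)%E.

Definition tensor (R : realType) (m n : nat) := {ffun 'I_m -> 'I_n} -> R.

Definition pascal_tensor (R : realType) (n : nat) (c : 'rV[R]_n) (m : nat)
  : tensor R m n :=
  fun idx => Gamma (\sum_(j < m) c 0 (idx j) + 1)
             / \prod_(j < m) Gamma (c 0 (idx j) + 1).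
Arguments pascal_tensor {R n} c m _.

Definition tpow (R : realType) (n : nat) (u : 'rV[R]_n) (m : nat) : tensor R m n :=
  fun idx => \prod_(j < m) u 0 (idx j).
Arguments tpow {R n} u m _.

Definition strongly_completely_positive (R : realType) (m n : nat)
  (A : tensor R m n) : Prop :=
  exists (r : nat) (U : 'M[R]_(r, n)),
    [/\ forall k i, 0 <= U k i,
        row_full U &
        forall idx, A idx = \sum_(k < r) tpow (row k U) m idx].

Definition tensor_form (R : realType) (m n : nat) (A : tensor R m n)
  (x : 'rV[R]_n) : R :=
  \sum_(idx : {ffun 'I_m -> 'I_n}) A idx * \prod_(j < m) x 0 (idx j).

Definition positive_definite (R : realType) (m n : nat) (A : tensor R m n) : Prop :=
  forall x : 'rV[R]_n, x != 0 -> 0 < tensor_form A x.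

(* Main.v *)
Require Import Defs.
From HB Require Import structures.
From mathcomp Require Import all_boot all_order all_algebra.
From mathcomp Require Import all_classical all_reals all_analysis.
From mathcomp Require Import measurable_realfun lra ring.
Import Order.TTheory GRing.Theory Num.Theory.
Import numFieldNormedType.Exports.
Local Open Scope ring_scope.

(** The Gamma integral gives [A = \int u(t)^m e^-t dt] over [t > 0], where
    [u_i(t) = t^c_i / Gamma(c_i + 1)].  To replace the integral by a finite sum,
    choose points [s_k] such that the tensors [u(s_k)^m] form a basis of the span
    of all [u(t)^m].  In the coordinates [phi] of this basis
    the cone generated by the curve contains the positive orthant.  If no point of
    this cone were strictly dominated, coordinatewise, by the coordinates of [A],
    a theorem of the alternative would give a nonzero [l >= 0] with
    [l . phi(t) >= 0] for all [t] and [\int l . phi(t) e^-t dt <= 0], which is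
    absurd as [l . phi(s_k) = l_k].  The positive slack is then spent on the points
    [s_k], so [A] is a positive combination of finitely many [u(t)^m], the [u(s_k)^m]
    among them.  A vector [x] orthogonal to each [u(s_k)] satisfies
    [(x . u(t))^m = 0] for every [t], and then positive definiteness of the Pascal
    matrix, whose form is [\int (x . u(t))^2 e^-t dt], forces [x = 0]. *)

(** * Theorem of the alternative for convex families *)

(** The point [(x', y')] lies strictly above the line of slope [- p] through the origin and
    [(x, y)], so the segment between the two points meets the diagonal in the open positive
    quadrant, where both coordinates equal [d / (1 + a)]. *)
Lemma crossing_combination (R : realFieldType) (x y x' y' p : R) :
  0 < x -> x' <= 0 -> 0 <= p -> y = - p * x -> 0 < p * x' + y' ->
  exists th : R, [/\ 0 < th < 1, 0 < th * x + (1 - th) * x' &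
                     0 < th * y + (1 - th) * y'].
Proof.
move=> x0 x'0 p0 -> h.
set d := (p * x' + y') / (p + 1); set z := d - x'.
have p1 : 0 < p + 1 by lra.
have d0 : 0 < d by rewrite divr_gt0.
have z0 : 0 < z by rewrite /z; lra.
have de : d * (p + 1) = p * x' + y' by rewrite /d divfK// gt_eqF.
set a := z / x.
have a0 : 0 < a by rewrite divr_gt0.
have ax : a * x = z by rewrite /a divfK// gt_eqF.
have a1 : 0 < 1 + a by lra.
have e1 : 1 - a / (1 + a) = 1 / (1 + a) by field; rewrite gt_eqF.
exists (a / (1 + a)); split.
- by rewrite divr_gt0//= ltr_pdivrMr//; lra.
- rewrite e1 (_ : _ + _ = (a * x + x') / (1 + a)); last by field; rewrite gt_eqF.
  by rewrite divr_gt0// ax /z; lra.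
- rewrite e1 (_ : _ + _ = (y' - p * (a * x)) / (1 + a)); last by field; rewrite gt_eqF.
  rewrite divr_gt0// ax /z.
  have -> : y' - p * (d - x') = p * x' + y' - d * (p + 1) + d by ring.
  lra.
Qed.

(* Induction on the number of coordinates: the first two are merged into
   [a * f 0 + b * f 1], the admissible ratio [a / b] being the infimum of
   [- f 1 / f 0] over the points where all the other coordinates are positive. *)
Lemma convex_alternative (R : realType) (T : Type) (S : T -> Prop) (n : nat)
    (f : 'I_n.+1 -> T -> R) :
  (forall s s' th, S s -> S s' -> 0 < th < 1 ->
     exists2 s'', S s'' & forall i, f i s'' = th * f i s + (1 - th) * f i s') ->
  (forall s, S s -> exists i, f i s <= 0) ->
  exists l : 'I_n.+1 -> R,
    [/\ forall i, 0 <= l i, exists i, 0 < l i &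
        forall s, S s -> \sum_i l i * f i s <= 0].
Proof.
elim: n f => [|n IH] f cvx neg.
  exists (fun=> 1); split=> //; first by exists ord0.
  move=> s Ss; rewrite big_ord1 mul1r; have [i] := neg _ Ss.
  by rewrite ord1.
pose i1 : 'I_n.+2 := lift ord0 ord0.
pose rest s := forall j : 'I_n, 0 < f (lift ord0 (lift ord0 j)) s.
suff [a [b [a0 b0 ab H]]] : exists a b : R, [/\ 0 <= a, 0 <= b, 0 < a + b &
    forall s, S s -> rest s -> a * f ord0 s + b * f i1 s <= 0].
  pose f' (i : 'I_n.+1) s :=
    if i == ord0 then a * f ord0 s + b * f i1 s else f (lift ord0 i) s.
  have [|s Ss|l [l0 [i li] lS]] := IH f'.
  - move=> s s' th Ss Ss' th01; have [s'' Ss'' E] := cvx _ _ _ Ss Ss' th01.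
    exists s'' => // i; rewrite /f'; case: ifP => _; rewrite !E//; ring.
  - have [[j fj]|nj] := pselect (exists j : 'I_n, f (lift ord0 (lift ord0 j)) s <= 0).
      by exists (lift ord0 j); rewrite /f'.
    exists ord0; rewrite /f' eqxx; apply: H => // j.
    by rewrite ltNge; apply/negP => ?; apply: nj; exists j.
  (* [L] undoes the merge: the first two coordinates share its weight [l ord0] as [a] to [b]. *)
  pose L i := if unlift ord0 i is Some j then
                if j == ord0 then b * l ord0 else l j else a * l ord0.
  exists L; split.
  - move=> k; rewrite /L; case: unlift => [j|]; last by rewrite mulr_ge0.
    by case: ifP => // _; rewrite mulr_ge0.
  - have [i0|i0] := eqVneq i ord0; last first.
      by exists (lift ord0 i); rewrite /L liftK (negbTE i0).
    rewrite i0 in li; have [a1|a1] := ltP 0 a.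
      by exists ord0; rewrite /L unlift_none mulr_gt0.
    by exists i1; rewrite /L liftK eqxx mulr_gt0//; lra.
  - move=> s Ss; have := lS s Ss.
    rewrite big_ord_recl [X in _ -> X <= _]big_ord_recl big_ord_recl.
    rewrite /L unlift_none liftK eqxx /f' eqxx /=.
    under eq_bigr do rewrite /=.
    under [X in _ -> _ + (_ + X) <= _]eq_bigr do rewrite liftK /=.
    rewrite mulrDr !mulrA addrA; congr (_ <= _).
    by rewrite ![_ * l ord0]mulrC.
pose A := [set p | exists s, [/\ S s, rest s, 0 < f ord0 s & p = - f i1 s / f ord0 s]]%classic.
have Alb p : A p -> 0 <= p.
  move=> [s [Ss rs s0 ->]]; rewrite divr_ge0 ?(ltW s0)// oppr_ge0.
  have [i] := neg _ Ss; case: (unliftP ord0 i) => [j ->|->]; last first.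
    by move=> /le_lt_trans => /(_ _ s0); rewrite ltxx.
  case: (unliftP ord0 j) => [k ->|-> //].
  by move=> /le_lt_trans => /(_ _ (rs k)); rewrite ltxx.
have [A0|A0] := pselect (exists p, A p); last first.
  (* As [A] is empty, [f ord0] is nonpositive wherever [rest] holds. *)
  exists 1, 0; split=> //.
  move=> s Ss rs; rewrite mul1r mul0r addr0 leNgt; apply/negP => s0.
  by apply: A0; eexists; exists s; split.
have Ainf : has_inf A by split=> //; exists 0 => p /Alb.
have mu0 : 0 <= inf A by apply: lb_le_inf => // p /Alb.
exists (inf A), 1; split=> //; first by lra.
move=> s Ss rs; rewrite mul1r.
have [s0|s0] := ltP 0 (f ord0 s).
  have : inf A <= - f i1 s / f ord0 s by apply: ge_inf; [case: Ainf | exists s].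
  by rewrite ler_pdivlMr//; lra.
rewrite leNgt; apply/negP => h.
(* The strict inequality [h] at [inf A] persists at some [p] in [A]: any [p] if [f ord0 s = 0], one
   close to the infimum if [f ord0 s < 0]. *)
have [p Ap hp] : exists2 p, A p & 0 < p * f ord0 s + f i1 s.
  have [e|e] := eqVneq (f ord0 s) 0.
    by case: A0 => p Ap; exists p => //; move: h; rewrite e !mulr0.
  have {e}s0 : f ord0 s < 0 by rewrite lt_neqAle e.
  have : inf A < f i1 s / - f ord0 s by rewrite ltr_pdivlMr; lra.
  rewrite -subr_gt0 => /inf_adherent -/(_ _ Ainf) [p Ap].
  by rewrite subrKC ltr_pdivlMr; [exists p => //; lra | lra].
have p0 := Alb _ Ap; case: Ap => s' [Ss' rs' s'0 pE].
(* Between [s'], which realises [p], and [s], some combination has its first two coordinates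
   positive, and the others stay positive, against [neg]. *)
have [|th [th01 h1 h2]] := crossing_combination _ (f ord0 s') (f i1 s') _ _ p s'0 s0 p0 _ hp.
  by rewrite pE mulNr divfK ?opprK ?gt_eqF.
have [s'' Ss'' E] := cvx _ _ _ Ss' Ss th01.
have [i] := neg _ Ss''; rewrite leNgt => /negP; apply; rewrite E.
have /andP[t0 t1] := th01.
case: (unliftP ord0 i) => [j ->|->//]; case: (unliftP ord0 j) => [k ->|->//].
by rewrite addr_gt0// mulr_gt0// ?subr_gt0.
Qed.

(** * Gamma integrals of combinations of powers *)

(** Raise [t / (2 * d) <= expR (t / (2 * d))] to the power [d]. This bounds the Gamma integrand by a
    multiple of [expR (- t / 2)]. *)
Lemma powR_le_expR (R : realType) (d t : R) :
  0 <= d -> 0 <= t -> t `^ d <= (2 * d) `^ d * expR (t / 2).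
Proof.
move=> d0 t0; have [->|dn0] := eqVneq d 0.
  by rewrite !powRr0 mul1r -expR0 ler_expR divr_ge0.
have {}d0 : 0 < d by rewrite lt_neqAle eq_sym dn0.
have -> : t / 2 = t / (2 * d) * d by field.
have e0 : 0 < 2 * d by rewrite mulr_gt0.
rewrite expRM -powRM ?expR_ge0 ?(ltW e0)//.
apply: ge0_ler_powR; rewrite ?nnegrE ?mulr_ge0 ?expR_ge0 ?(ltW d0)//.
rewrite mulrC -ler_pdivrMr//.
by apply: le_trans (expR_ge1Dx _); rewrite lerDr.
Qed.

Lemma Gamma_integrable (R : realType) (d : R) : 0 <= d ->
  (@lebesgue_measure R).-integrable `]0, +oo[%classic
    (fun t => (t `^ d * expR (- t))%:E).
Proof.
move=> d0.
(* Dominate by the exponential density of rate 1/2; the factor 2 cancels the rate in that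
   density. *)
have hexp : (@lebesgue_measure R).-integrable `]0, +oo[%classic
    (fun t => ((2 * (2 * d) `^ d)%:E * (exponential_pdf 2^-1 t)%:E)%E).
  apply: integrableZl => //.
  have := @integrable_exponential_pdf R 2^-1.
  rewrite invr_gt0 ltr0n => /(_ isT).
  exact: integrableS.
apply: (le_integrable _ _ _ hexp) => //.
- apply/measurable_EFinP; apply: measurable_funM.
    by apply: measurable_funTS; exact: measurable_powR.
  by apply: measurable_funTS; apply: measurableT_comp.
- move=> t /=; rewrite in_itv/= andbT => t0.
  rewrite lee_fin ger0_norm ?mulr_ge0 ?powR_ge0 ?expR_ge0//.
  rewrite ger0_norm; last by rewrite mulr_ge0 ?exponential_pdf_ge0 ?mulr_ge0 ?powR_ge0.
  rewrite exponential_pdfE ?(ltW t0)//.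
  have -> : 2 * (2 * d) `^ d * (2^-1 * expR (- 2^-1 * t)) =
    (2 * d) `^ d * expR (t / 2) * expR (- t).
    rewrite -[RHS]mulrA -expRD (_ : t / 2 - t = - 2^-1 * t); last by field.
    by field.
  by rewrite ler_pM2r ?expR_gt0// powR_le_expR// ltW.
Qed.

Lemma Gamma_comb_integral (R : realType) (I : finType) (d a : I -> R) :
  (forall i, 0 <= d i) ->
  (\sum_i a i * Gamma (d i + 1))%:E =
  (\int[@lebesgue_measure R]_(t in `]0%R, +oo[)
     ((\sum_i a i * t `^ d i) * expR (- t))%:E)%E.
Proof.
move=> d0.
under eq_integral => t _.
  rewrite mulr_suml -sumEFin.
  under eq_bigr do rewrite -mulrA EFinM.
  over.
rewrite integral_sum//=; last first.
  by move=> i; apply: integrableZl => //; exact: Gamma_integrable.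
rewrite -sumEFin; apply: eq_bigr => i _.
have Ii := Gamma_integrable _ _ (d0 i).
rewrite integralZl// EFinM /Gamma; congr (_ * _)%E.
under [in LHS]eq_integral do rewrite addrK.
rewrite fineK//; exact: integrable_fin_num.
Qed.

Lemma powR_comb_cvg (R : realType) (I : finType) (d a : I -> R) (s : R) :
  0 < s ->
  ((fun t : R => \sum_i a i * t `^ d i) t @[t --> s] --> \sum_i a i * s `^ d i)%classic.
Proof.
move=> s0.
elim: (index_enum I) => [|i r IH].
  by under eq_fun do rewrite big_nil; rewrite big_nil; exact: cvg_cst.
under eq_fun do rewrite big_cons.
rewrite big_cons.
apply: cvgD => //; apply: cvgM; first exact: cvg_cst.
have : {for s, continuous (@powR R ^~ (d i))}.
  apply/differentiable_continuous/derivable1_diffP.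
  by apply: derivable_powR; rewrite in_itv/= s0.
exact.
Qed.

Lemma Gamma_comb_ge0 (R : realType) (I : finType) (d a : I -> R) :
  (forall i, 0 <= d i) -> (forall t, 0 < t -> 0 <= \sum_i a i * t `^ d i) ->
  0 <= \sum_i a i * Gamma (d i + 1).
Proof.
move=> d0 f0; rewrite -lee_fin Gamma_comb_integral//.
apply: integral_ge0 => t /=; rewrite in_itv/= andbT => t0.
by rewrite lee_fin mulr_ge0 ?expR_ge0 ?f0.
Qed.

(** By continuity the sum stays above half its value at [s] on some [[s, s + e]], and this interval
    alone makes the integral positive. *)
Lemma Gamma_comb_gt0 (R : realType) (I : finType) (d a : I -> R) (s : R) :
  (forall i, 0 <= d i) -> (forall t, 0 < t -> 0 <= \sum_i a i * t `^ d i) ->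
  0 < s -> 0 < \sum_i a i * s `^ d i ->
  0 < \sum_i a i * Gamma (d i + 1).
Proof.
move=> d0 f0 s0 fs; rewrite -lte_fin Gamma_comb_integral//.
set f := fun t => \sum_i a i * t `^ d i in f0 fs *.
have [e /= e0 He] : exists2 e : R, 0 < e & forall t, s <= t <= s + e -> f s / 2 <= f t.
  have := @powR_comb_cvg _ _ d a _ s0.
  move=> /cvgrPdist_lt /(_ (f s / 2)); rewrite divr_gt0// => /(_ isT).
  move=> /nbhs_ballP[e /= e0 H]; exists (e / 2); first by rewrite divr_gt0.
  move=> t /andP[st te].
  have : `|f s - f t| < f s / 2.
    apply: H; rewrite /ball/= ltr_norml; apply/andP; split; lra.
  by rewrite ltr_norml => /andP[_]; lra.
set g := fun t => (f t * expR (- t))%:E.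
have mg : measurable_fun (`]0, +oo[%classic : set R) g.
  apply/measurable_EFinP; apply: measurable_funM.
    apply: measurable_sum => i; apply: measurable_funM => //.
    by apply: measurable_funTS; exact: measurable_powR.
  by apply: measurable_funTS; apply: measurableT_comp.
have sub : (`[s, s + e] `<=` (`]0%R, +oo[ : set R))%classic.
  move=> t /=; rewrite !in_itv/= andbT => /andP[st _]; exact: lt_le_trans st.
apply: (@lt_le_trans _ _
  (\int[@lebesgue_measure R]_(t in `[s, (s + e)%R]%classic) g t)%E); last first.
  apply: ge0_subset_integral => //.
  move=> t /=; rewrite in_itv/= andbT => t0.
  by rewrite lee_fin mulr_ge0 ?expR_ge0 ?f0.
have k0 : 0 < f s / 2 * expR (- (s + e)) by rewrite mulr_gt0 ?divr_gt0 ?expR_gt0.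
apply: (@lt_le_trans _ _ (\int[@lebesgue_measure R]_(t in `[s, (s + e)%R]%classic)
   (cst (f s / 2 * expR (- (s + e)))%:E t))%E).
  rewrite integral_cst//= lebesgue_measure_itv/= lte_fin ltrDl e0.
  by rewrite -EFinB -EFinM lte_fin mulr_gt0//; lra.
apply: ge0_le_integral => //.
- by move=> t _; rewrite lee_fin ltW.
- exact: measurable_funS mg.
- move=> t /=; rewrite in_itv/= => /andP[st te].
  rewrite lee_fin ler_pM ?expR_ge0 ?divr_ge0 ?(ltW fs)//.
    by apply: He; rewrite st.
  by rewrite ler_expR lerN2.
Qed.

(** * From an integral to a finite positive combination *)

(** Take as many independent values of [v] as possible: a [v t] outside their span could be
    added. *)
Lemma interpolation_points (F : fieldType) (T : Type) (N : nat)
    (v : T -> 'rV[F]_N) :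
  exists r (s : 'I_r -> T),
    row_free (\matrix_k v (s k)) /\
    forall t, (v t <= \matrix_k v (s k))%MS.
Proof.
pose P r := `[< exists s : 'I_r -> T, row_free (\matrix_k v (s k)) >].
have P0 : exists r, P r.
  exists 0%N; apply/asboolP.
  have s0 : 'I_0 -> T by case.
  by exists s0; rewrite /row_free flatmx0 mxrank0.
have PN r : P r -> (r <= N)%N.
  by move=> /asboolP[s /eqP <-]; exact: rank_leq_col.
case: (ex_maxnP P0 PN) => r /asboolP[s fs] rmax.
exists r, s; split=> // t.
apply: contraT => nt; suff /rmax : P r.+1 by rewrite ltnn.
apply/asboolP; exists (fun k => if unlift ord0 k is Some j then s j else t).
set M := \matrix_k v (s k) in fs nt.
set M' := \matrix_k _.
have -> : M' = col_mx (v t) M :> 'M[F]_(1 + r, N).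
  apply/row_matrixP => k; rewrite rowK.
  case: (split_ordP k) => j ->.
    have -> : lshift r j = ord0 :> 'I_r.+1 by apply: val_inj; rewrite ord1.
    rewrite unlift_none (_ : (ord0 : 'I_r.+1) = lshift r (ord0 : 'I_1)).
      by rewrite rowKu row_id.
    exact: val_inj.
  have -> : rshift 1 j = lift ord0 j :> 'I_r.+1 by exact: val_inj.
  by rewrite liftK (_ : lift ord0 j = rshift 1 j) ?rowKd ?rowK//; exact: val_inj.
rewrite /row_free eqn_leq rank_leq_row /= -(addsmxE (v t) M).
suff : (\rank M < \rank (v t + M)%MS)%N by rewrite (eqP fs).
by apply: rank_ltmx; rewrite ltmxE addsmxSr addsmx_sub negb_and nt.
Qed.

(** The alternative is applied to the slacks of finite positive combinations. The weights it yields
    are nonpositive on [beta], by the empty combination, and nonnegative on each [phi t], by its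
    large multiples, against the hypothesis. *)
Lemma strict_conic_domination (R : realType) (T : Type) (r : nat)
    (phi : T -> 'rV[R]_r) (beta : 'rV[R]_r) :
  (forall L : 'cV_r, L != 0 -> (forall i, 0 <= L i 0) ->
     (forall t, 0 <= (phi t *m L) 0 0) -> 0 < (beta *m L) 0 0) ->
  exists p : seq (R * T), all (fun q => 0 < q.1) p /\
    forall k, 0 < (beta - \sum_(q <- p) q.1 *: phi q.2) 0 k.
Proof.
(* [convex_alternative] needs at least one coordinate. *)
move=> dual; case: r phi beta dual => [|r] phi beta dual.
  by exists [::]; split=> // -[].
apply: contrapT => H.
pose S (p : seq (R * T)) : Prop := all (fun q => 0 < q.1) p.
pose f (k : 'I_r.+1) (p : seq (R * T)) := (beta - \sum_(q <- p) q.1 *: phi q.2) 0 k.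
have [||l [l0 [k lk] lS]] := convex_alternative _ _ S _ f.
- move=> p p' th Sp Sp' /andP[th0 th1].
  exists ([seq (th * q.1, q.2) | q <- p] ++ [seq ((1 - th) * q.1, q.2) | q <- p']).
    rewrite /S all_cat !all_map; apply/andP; split.
      by apply: sub_all Sp => q q0 /=; rewrite mulr_gt0.
    by apply: sub_all Sp' => q q0 /=; rewrite mulr_gt0 ?subr_gt0.
  have scaled u w : \sum_(q <- [seq (u * q.1, q.2) | q <- w]) q.1 *: phi q.2 =
      u *: \sum_(q <- w) q.1 *: phi q.2.
    by rewrite big_map scaler_sumr; apply: eq_bigr => q _; rewrite scalerA.
  by move=> i; rewrite /f big_cat /= !scaled !mxE; ring.
- move=> p Sp; apply: contrapT => nf; apply: H; exists p; split=> // k.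
  by rewrite ltNge; apply/negP => ?; apply: nf; exists k.
pose L : 'cV_r.+1 := \col_i l i.
have LE p : \sum_i l i * f i p = (beta *m L) 0 0 - \sum_(q <- p) q.1 * (phi q.2 *m L) 0 0.
  have -> : \sum_i l i * f i p = ((beta - \sum_(q <- p) q.1 *: phi q.2) *m L) 0 0.
    by rewrite mxE; apply: eq_bigr => i _; rewrite /f [L _ _]mxE mulrC.
  rewrite mulmxBl mulmx_suml !mxE summxE; congr (_ - _).
  by apply: eq_bigr => q _; rewrite -scalemxAl !mxE.
have b0 : (beta *m L) 0 0 <= 0.
  by have := lS [::] isT; rewrite LE big_nil subr0.
have phi0 t : 0 <= (phi t *m L) 0 0.
  rewrite leNgt; apply/negP => neg.
  set y := (phi t *m L) 0 0 in neg.
  (* otherwise [lS] fails on a large enough multiple of [phi t] *)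
  have : (beta *m L) 0 0 -
      \sum_(q <- [:: ((1 - (beta *m L) 0 0) / - y, t)])
         q.1 * (phi q.2 *m L) 0 0 <= 0.
    rewrite -LE; apply: lS; rewrite /S /= andbT divr_gt0//; lra.
  rewrite big_seq1 /= -/y (_ : _ / - y * y = (beta *m L) 0 0 - 1); first lra.
  by field; rewrite lt_eqF.
suff : 0 < (beta *m L) 0 0 by rewrite ltNge b0.
apply: dual => //; last by move=> i; rewrite mxE.
by apply/eqP => /colP/(_ k); rewrite !mxE => /eqP; rewrite gt_eqF.
Qed.

(** The hypotheses on [G] are those satisfied by an integral of [v] against a positive density. The
    last conclusion comes from having the interpolation points among the nodes. *)
Lemma conic_quadrature (R : realType) (T : Type) (N : nat) (v : T -> 'rV[R]_N)
    (G : 'rV[R]_N) :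
  (forall a : 'cV_N, (forall t, v t *m a = 0) -> G *m a = 0) ->
  (forall (a : 'cV_N) s, (forall t, 0 <= (v t *m a) 0 0) -> 0 < (v s *m a) 0 0 ->
     0 < (G *m a) 0 0) ->
  exists (p : seq (R * T)),
    [/\ forall i : 'I_(size p), 0 < (tnth (in_tuple p) i).1,
        G = \sum_(q <- p) q.1 *: v q.2 &
        forall a : 'cV_N,
          (forall i : 'I_(size p), v (tnth (in_tuple p) i).2 *m a = 0) ->
          forall t, v t *m a = 0].
Proof.
move=> G0 Gpos.
have [r [s [fs vM]]] := interpolation_points _ _ _ v.
set M := \matrix_k v (s k) in fs vM.
pose phi t := v t *m pinvmx M.
pose beta := G *m pinvmx M.
have vE t : v t = phi t *m M by rewrite /phi mulmxKpV.
have GE : G = beta *m M.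
  apply/subr0_eq/rowP => j; rewrite mxE.
  (* The columns of [1%:M - pinvmx M *m M] annihilate every [v t], hence [G], which puts [G] in the
     row space of [M]. *)
  have := G0 ((1%:M - pinvmx M *m M) *m delta_mx j 0).
  have zero t : v t *m ((1%:M - pinvmx M *m M) *m (delta_mx j 0 : 'cV_N)) = 0.
    by rewrite mulmxA mulmxBr mulmx1 mulmxA -/(phi t) -vE subrr mul0mx.
  move=> /(_ zero); rewrite mulmxA mulmxBr mulmx1 mulmxA -/beta -colE => /colP /(_ 0).
  by rewrite !mxE.
have phis k : phi (s k) = delta_mx 0 k.
  rewrite /phi -[v (s k)](rowK (fun k => v (s k))) -/M rowE -mulmxA mulmxVp//.
  by rewrite mulmx1.
have [|p [p0 pb]] := @strict_conic_domination R T r phi beta.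
  move=> L L0 Lge0 phiL.
  have [k Lk] : exists k, 0 < L k 0.
    apply: contrapT => nL; case/eqP: L0; apply/colP => k; rewrite mxE.
    apply/eqP; rewrite eq_le Lge0 andbT leNgt; apply/negP => ?; apply: nL.
    by exists k.
  have aE t : v t *m (pinvmx M *m L) = phi t *m L by rewrite mulmxA.
  rewrite /beta -mulmxA; apply: (Gpos _ (s k)) => [t|]; rewrite aE//.
  by rewrite phis -rowE !mxE.
set d := beta - _ in pb.
(* Since [phi (s k)] is the [k]-th unit vector, the slack [d 0 k] is the weight to give to [s k]. *)
exists (p ++ [seq (d 0 k, s k) | k <- enum 'I_r]).
set P := _ ++ _.
have P0 : all (fun q => 0 < q.1) P.
  by rewrite /P all_cat p0 all_map; apply/allP => k _; exact: pb.
split.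
- by move: P0; rewrite -[P]/(tval (in_tuple P)) => /all_tnthP.
- rewrite /P big_cat big_map /= big_enum /= GE.
  have -> : beta = \sum_(q <- p) q.1 *: phi q.2 + d by rewrite /d subrKC.
  rewrite mulmxDl mulmx_suml; congr (_ + _).
    by apply: eq_bigr => q _; rewrite -scalemxAl -vE.
  rewrite mulmx_sum_row; apply: eq_bigr => k _.
  by rewrite rowK.
- move=> a Ha t; rewrite vE -mulmxA.
  suff -> : M *m a = 0 by rewrite mulmx0.
  apply/row_matrixP => k; rewrite row_mul rowK row0.
  have kP : (size p + k < size P)%N.
    by rewrite /P size_cat size_map size_enum_ord ltn_add2l.
  have := Ha (Ordinal kP); rewrite (tnth_nth (0, s k))/= /P nth_cat.
  rewrite ltnNge leq_addr /= addKn (nth_map k) ?size_enum_ord//=.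
  by rewrite nth_ord_enum.
Qed.

(** * Linear forms on the Pascal curve and on the Pascal tensor *)

Lemma tensor_form_tpow (R : realType) (n m : nat) (w x : 'rV[R]_n) :
  tensor_form (tpow w m) x = ((w *m x^T) 0 0) ^+ m.
Proof.
rewrite mxE.
under [in RHS]eq_bigr do rewrite mxE.
rewrite -[in RHS](card_ord m) -prodr_const bigA_distr_bigA.
by apply: eq_bigr => f _; rewrite /tpow -big_split.
Qed.

Definition pascal_curve (R : realType) (n : nat) (c : 'rV[R]_n) (t : R) : 'rV[R]_n :=
  \row_i (t `^ c 0 i / Gamma (c 0 i + 1)).

Lemma powR_sum (R : realType) (I : finType) (f : I -> R) (t : R) :
  0 < t -> t `^ (\sum_i f i) = \prod_i t `^ f i.
Proof.
move=> t0; apply: (big_morph (powR t)) => [x y|]; last by rewrite powRr0.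
by rewrite powRD ?(gt_eqF t0) ?implybT.
Qed.

Lemma tpow_pascal_curve (R : realType) (n : nat) (c : 'rV[R]_n) m t idx : 0 < t ->
  tpow (pascal_curve _ _ c t) m idx =
  t `^ (\sum_(j < m) c 0 (idx j)) / \prod_(j < m) Gamma (c 0 (idx j) + 1).
Proof.
move=> t0; rewrite /tpow /pascal_curve powR_sum//.
rewrite -prodf_div; apply: eq_bigr => j _; exact: mxE.
Qed.

Lemma Gamma_ge0 (R : realType) (x : R) : 0 <= Gamma x.
Proof.
by rewrite /Gamma fine_ge0// integral_ge0// => t _; rewrite lee_fin mulr_ge0 ?powR_ge0 ?expR_ge0.
Qed.

(** To be compared with [pascal_combE]: the same coefficients multiply powers [t ^ d] here and
    [Gamma (d + 1)] there, so the Gamma lemmas carry signs from the curve to the tensor. *)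
Lemma pascal_curve_combE (R : realType) (n : nat) (c : 'rV[R]_n) (m : nat) a t :
  0 < t ->
  \sum_idx tpow (pascal_curve _ _ c t) m idx * a idx =
  \sum_(idx : {ffun 'I_m -> 'I_n})
    a idx / (\prod_(j < m) Gamma (c 0 (idx j) + 1)) * t `^ (\sum_(j < m) c 0 (idx j)).
Proof.
move=> t0; apply: eq_bigr => idx _; rewrite tpow_pascal_curve//.
by rewrite mulrC mulrAC mulrA.
Qed.

Lemma pascal_combE (R : realType) (n : nat) (c : 'rV[R]_n) (m : nat) a :
  \sum_idx pascal_tensor c m idx * a idx =
  \sum_(idx : {ffun 'I_m -> 'I_n})
    a idx / (\prod_(j < m) Gamma (c 0 (idx j) + 1))
    * Gamma (\sum_(j < m) c 0 (idx j) + 1).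
Proof.
apply: eq_bigr => idx _; rewrite /pascal_tensor.
by rewrite mulrC mulrAC mulrA.
Qed.

Lemma pascal_comb_ge0 (R : realType) (n : nat) (c : 'rV[R]_n) (m : nat) a :
  (forall i, 0 <= c 0 i) ->
  (forall t, 0 < t -> 0 <= \sum_idx tpow (pascal_curve _ _ c t) m idx * a idx) ->
  0 <= \sum_idx pascal_tensor c m idx * a idx.
Proof.
move=> c0 H; rewrite pascal_combE.
apply: Gamma_comb_ge0 => [idx|t t0]; first exact: sumr_ge0.
by rewrite -pascal_curve_combE// H.
Qed.

Lemma pascal_comb_gt0 (R : realType) (n : nat) (c : 'rV[R]_n) (m : nat) a s :
  (forall i, 0 <= c 0 i) ->
  (forall t, 0 < t -> 0 <= \sum_idx tpow (pascal_curve _ _ c t) m idx * a idx) ->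
  0 < s -> 0 < \sum_idx tpow (pascal_curve _ _ c s) m idx * a idx ->
  0 < \sum_idx pascal_tensor c m idx * a idx.
Proof.
move=> c0 H s0 Hs; rewrite pascal_combE.
apply: (Gamma_comb_gt0 _ _ _ _ s) => //; first by move=> idx; exact: sumr_ge0.
  by move=> t t0; rewrite -pascal_curve_combE// H.
by rewrite -pascal_curve_combE.
Qed.

Lemma pascal_comb_eq0 (R : realType) (n : nat) (c : 'rV[R]_n) m a :
  (forall i, 0 <= c 0 i) ->
  (forall t, 0 < t -> \sum_idx tpow (pascal_curve _ _ c t) m idx * a idx = 0) ->
  \sum_idx pascal_tensor c m idx * a idx = 0.
Proof.
move=> c0 H; apply/eqP; rewrite eq_le; apply/andP; split; last first.
  by apply: pascal_comb_ge0 => // t t0; rewrite H.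
rewrite -oppr_ge0 -sumrN.
under eq_bigr do rewrite -mulrN.
apply: (pascal_comb_ge0 _ _ _ _ (fun idx => - a idx)) => // t t0.
by under eq_bigr do rewrite mulrN; rewrite sumrN H ?oppr0.
Qed.

(** The quadratic form of [x] on the curve is the square of the vanishing pairing, so the form of
    the Pascal matrix vanishes at [x]. *)
Lemma pascal_curve_spans (R : realType) (n : nat) (c : 'rV[R]_n) (x : 'rV[R]_n) :
  (forall i, 0 <= c 0 i) -> positive_definite (pascal_tensor c 2) ->
  (forall t, 0 < t -> (pascal_curve _ _ c t *m x^T) 0 0 = 0) -> x = 0.
Proof.
move=> c0 pd H; apply/eqP; apply: contraT => /pd.
rewrite /tensor_form pascal_comb_eq0 ?ltxx// => t t0.
by have := tensor_form_tpow _ _ 2 (pascal_curve _ _ c t) x; rewrite H// expr0n.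
Qed.

Theorem theorem4p2 (R : realType) (n : nat) (c : 'rV[R]_n) :
  (2 <= n)%N ->
  (forall i, 0 <= c 0 i) ->
  (forall i : 'I_n, nat_of_ord i = 0%N -> c 0 i = 0) ->
  positive_definite (pascal_tensor c 2) ->
  forall m : nat, (2 <= m)%N ->
    strongly_completely_positive (pascal_tensor c m) /\
    (~~ odd m -> positive_definite (pascal_tensor c m)).
Proof.
move=> _ c0 _ pd m m2.
have m0 : (0 < m)%N by exact: leq_trans m2.
pose I := {ffun 'I_m -> 'I_n}.
pose flat (A : tensor R m n) : 'rV[R]_#|I| := \row_k A (enum_val k).
(* [expR] parametrises the half-line [t > 0] by the whole type [R]. *)
pose v (s : R) := flat (tpow (pascal_curve _ _ c (expR s)) m).
have flatE (A : tensor R m n) (a : 'cV_#|I|) :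
    (flat A *m a) 0 0 = \sum_idx A idx * a (enum_rank idx) 0.
  rewrite mxE (reindex_onto enum_rank enum_val) /=; last by move=> k _; rewrite enum_valK.
  apply: eq_big => [i|i _]; first by rewrite enum_rankK eqxx.
  by rewrite mxE enum_rankK.
have vE (s : R) (a : 'cV_#|I|) := flatE (tpow (pascal_curve _ _ c (expR s)) m) a.
have expE (P : R -> Prop) : (forall s, P (expR s)) -> forall t, 0 < t -> P t.
  by move=> H t t0; rewrite -(@lnK _ t)// posrE.
have [||p [p0 pE pspan]] := @conic_quadrature R R _ v (flat (pascal_tensor c m)).
- move=> a Ha; apply/rowP => j; rewrite ord1 flatE mxE.
  apply: pascal_comb_eq0 => //; apply: expE => s.
  by rewrite -vE Ha mxE.
- move=> a s Ha Hs; rewrite flatE; apply: (pascal_comb_gt0 _ _ _ _ _ (expR s)) => //.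
  + by apply: expE => t; have := Ha t; rewrite vE.
  + exact: expR_gt0.
  + by move: Hs; rewrite vE.
pose w i := (tnth (in_tuple p) i).1.
pose tt i := expR (tnth (in_tuple p) i).2.
(* The [m]-th root of the weight is absorbed into the vector, so that [tpow] returns [w k]. *)
pose U : 'M[R]_(size p, n) := \matrix_k (w k `^ (m%:R^-1) *: pascal_curve _ _ c (tt k)).
have mR : (m%:R : R) != 0 by rewrite pnatr_eq0 -lt0n.
have UE idx : pascal_tensor c m idx = \sum_(k < size p) tpow (row k U) m idx.
  have /rowP /(_ (enum_rank idx)) := pE.
  rewrite mxE enum_rankK => ->.
  rewrite summxE (big_tnth _ _ p); apply: eq_bigr => k _.
  rewrite rowK /tpow !mxE enum_rankK.
  under [in RHS]eq_bigr do rewrite mxE.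
  rewrite big_split /= prodr_const card_ord -powR_mulrn ?powR_ge0// -powRrM mulVf//.
  by rewrite powRr1 ?(ltW (p0 k)).
have Ukern (x : 'rV[R]_n) : (forall k, (row k U *m x^T) 0 0 = 0) -> x = 0.
  move=> Hx; apply: (pascal_curve_spans _ _ c) => //; apply: expE => s.
  have Hk k : (pascal_curve R n c (tt k) *m x^T) 0 0 = 0.
    have /eqP := Hx k; rewrite rowK -scalemxAl mxE mulf_eq0 (gt_eqF (powR_gt0 _ (p0 k))).
    by move/eqP.
  (* Pairing a flattened tensor with [a] evaluates its form at [x]. *)
  pose a : 'cV[R]_#|I| := \col_k \prod_j x 0 ((enum_val k : I) j).
  have va t : (v t *m a) 0 0 = ((pascal_curve R n c (expR t) *m x^T) 0 0) ^+ m.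
    rewrite vE -tensor_form_tpow; apply: eq_bigr => idx _.
    by rewrite mxE enum_rankK.
  have Z k : v (tnth (in_tuple p) k).2 *m a = 0.
    by apply/rowP => j; rewrite ord1 va Hk [RHS]mxE expr0n gtn_eqF.
  have /rowP/(_ 0) := pspan a Z s; rewrite va [RHS]mxE => /eqP.
  by rewrite expf_eq0 m0 => /eqP.
split.
- exists (size p), U; split=> //.
  + move=> k i; rewrite mxE mxE [pascal_curve _ _ _ _ _ _]mxE mulr_ge0 ?powR_ge0// divr_ge0 ?powR_ge0//.
    exact: Gamma_ge0.
  (* Each column of [cokermx U] is orthogonal to all rows of [U], hence zero by [Ukern]. *)
  + rewrite -cokermx_eq0; apply/eqP/trmx_inj/row_matrixP => j; rewrite trmx0 row0.
    apply: Ukern => k; rewrite tr_row trmxK.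
    have : row k U *m col j (cokermx U) = 0.
      by rewrite colE mulmxA -row_mul mulmx_coker row0 mul0mx.
    by move=> ->; rewrite mxE.
- move=> evm x xn0.
  (* The form is a sum of even powers, all zero only if [x] is orthogonal to every row of [U]. *)
  have -> : tensor_form (pascal_tensor c m) x = \sum_k ((row k U *m x^T) 0 0) ^+ m.
    under [RHS]eq_bigr do rewrite -tensor_form_tpow.
    rewrite /tensor_form exchange_big /=; apply: eq_bigr => idx _.
    by rewrite UE mulr_suml.
  have ge0 k : 0 <= ((row k U *m x^T) 0 0) ^+ m by rewrite exprn_even_ge0.
  rewrite lt_neqAle sumr_ge0// andbT eq_sym psumr_neq0//.
  apply: contraT => /hasPn H; case/eqP: xn0; apply: Ukern => k.
  have := H k (mem_index_enum k); rewrite /= -leNgt => hk.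
  have : ((row k U *m x^T) 0 0) ^+ m == 0 by rewrite eq_le hk ge0.
  by rewrite expf_eq0 m0 => /eqP.
Qed.
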